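(* Let $0<p<1$. There exists a solution $(x,y):\mathbb{R}\to\mathbb{R}^2$ to (S) with zero-value $(0,\beta)$, for some $\beta>0$ with $$\sqrt{\frac{(1-p)^{2/(1-p)}}{1+p}}\le\beta\le\sqrt{2\left(\big((1-p)^{1/(1-p)}-m_H\big)^2-m_H^2\right)},$$ which satisfies $$(x(\eta),y(\eta))\to(\pm(1-p)^{1/(1-p)},0)\quad\text{as }\eta\to\pm\infty$$ and $$|x(\eta)|<(1-p)^{1/(1-p)},\qquad 0<y(\eta)\le\beta\qquad\text{for all }\eta\in\mathbb{R}.$$
   Context: Fix $0<p<1$; $x|x|^{p-1}$ is taken to be $0$ at $x=0$. Problem (S) with zero-value $(\alpha,\beta)\in\mathbb{R}^2$ is $x'=y$, $y'=\frac{1}{1-p}x-x|x|^{p-1}-\frac12\eta y$, $(x(0),y(0))=(\alpha,\beta)$, where $'=d/d\eta$. A solution on $\mathbb{R}$ is a bounded pair $(x,y)\in C^1(\mathbb{R})\cap L^\infty(\mathbb{R})$ satisfying these equations on $\mathbb{R}$. Put $H(x)=\frac{1}{1-p}x-x|x|^{p-1}$ and $m_H=\inf_{\lambda\in[0,(1-p)^{1/(1-p)}]}H(\lambda)$. *)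

(* Defs.v *)
From Stdlib Require Export Reals.
From Coquelicot Require Export Coquelicot.
Open Scope R_scope.

(* x|x|^(p-1).  At x = 0 the factor Rpower 0 (p-1) is a junk value, but it is
   multiplied by 0, so the result is 0 as required. *)
Definition signed_pow (p x : R) : R := x * Rpower (Rabs x) (p - 1).

Definition H (p x : R) : R := / (1 - p) * x - signed_pow p x.

(* (1-p)^(1/(1-p)), the positive zero of H p. *)
Definition xstar (p : R) : R := Rpower (1 - p) (/ (1 - p)).

(* For 0 < p < 1 the set is nonempty and bounded, so the extended-real
   infimum is finite and [real] loses nothing. *)
Definition m_H (p : R) : R :=
  real (Glb_Rbar (fun z => exists lambda, 0 <= lambda <= xstar p /\ z = H p lambda)).

Definition C1 (f : R -> R) : Prop :=
  (forall t, ex_derive f t) /\ (forall t, continuous (Derive f) t).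

(* For continuous functions, membership in L^infty(R) is boundedness. *)
Definition bounded_fun (f : R -> R) : Prop :=
  exists M, forall t, Rabs (f t) <= M.

(* (x, y) is a (global, bounded) solution of (S) with zero-value (alpha, beta). *)
Definition solution_S (p alpha beta : R) (x y : R -> R) : Prop :=
  (C1 x /\ bounded_fun x) /\ (C1 y /\ bounded_fun y) /\
  (forall eta, is_derive x eta (y eta)) /\
  (forall eta, is_derive y eta
     (/ (1 - p) * x eta - signed_pow p (x eta) - / 2 * eta * y eta)) /\
  x 0 = alpha /\ y 0 = beta.

(* Main.v *)
(* Only the half-line t >= 0 matters, since the equation is invariant under the odd extension.
   There, with K = 1/(1-p), subtracting (c^2 - 1/2 + c t/2) x from both sides of
   x'' + t/2 x' = K x - x^p makes the right-hand side decreasing in x, and the linear operator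
   on the left factors into two first-order ones, so its Dirichlet inverse is explicit and order reversing.
   Composing, one gets a monotone map whose greatest fixed point above the subsolution
   eps t^2/(1+t^2) exists by Knaster-Tarski; no shooting and no Lipschitz condition
   at x = 0 are needed.  As H <= 0 on [0, xstar], the fixed point has nonincreasing derivative,
   and staying away from both 0 and xstar forever would make it decrease like -log t,
   so it increases to xstar.  The bounds on beta come from two functionals of (x, x') that are
   monotone along the orbit. *)
Require Import Defs.
From Stdlib Require Import Reals Lra Psatz Classical.
From Coquelicot Require Import Coquelicot.
Open Scope R_scope.

(** * Calculus tools: monotonicity from the sign of a derivative, primitives *)

Ltac ex_derive_by_hyp :=
  repeat match goal with
  | |- _ /\ _ => split
  | |- True => exact I
  | |- ex_derive _ _ => eexists; eassumption
  end.

Ltac rewrite_derive := repeat (erewrite is_derive_unique; [|eassumption]).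

Lemma le_of_derive_nonneg_open (f df : R -> R) (a b : R) :
  a <= b ->
  (forall t, a < t < b -> is_derive f t (df t) /\ 0 <= df t) ->
  (forall t, a <= t <= b -> continuity_pt f t) ->
  f a <= f b.
Proof.
intros hab hd hc.
(* [MVT_gen] may return an endpoint, where nothing is known of [df]; the extension by 0 keeps the
   sign there. *)
set (dg := fun t => if Rlt_dec a t then if Rlt_dec t b then df t else 0 else 0).
destruct (MVT_gen f a b dg) as [c [_ hfc]].
- rewrite Rmin_left, Rmax_right by lra. intros t ht. unfold dg.
  destruct (Rlt_dec a t); [|lra]. destruct (Rlt_dec t b); [|lra]. now apply hd.
- rewrite Rmin_left, Rmax_right by lra. exact hc.
- assert (0 <= dg c).
  { unfold dg. destruct (Rlt_dec a c); [|lra]. destruct (Rlt_dec c b); [|lra].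
    now apply hd. }
  assert (0 <= dg c * (b - a)) by (apply Rmult_le_pos; lra). lra.
Qed.

Lemma continuity_pt_of_derive (f : R -> R) (t l : R) :
  is_derive f t l -> continuity_pt f t.
Proof.
intros h. apply continuity_pt_filterlim, (ex_derive_continuous f). now exists l.
Qed.

Lemma le_of_derive_nonneg (f df : R -> R) (a b : R) :
  a <= b ->
  (forall t, a <= t <= b -> is_derive f t (df t) /\ 0 <= df t) ->
  f a <= f b.
Proof.
intros hab hd. apply le_of_derive_nonneg_open with df; [exact hab| |].
- intros t ht. apply hd. lra.
- intros t ht. apply continuity_pt_of_derive with (df t). now apply hd.
Qed.

Lemma le_of_derive_nonpos (f df : R -> R) (a b : R) :
  a <= b ->
  (forall t, a <= t <= b -> is_derive f t (df t) /\ df t <= 0) ->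
  f b <= f a.
Proof.
intros hab hd.
enough (- f a <= - f b) by lra.
apply (le_of_derive_nonneg (fun t => - f t) (fun t => - df t)); [exact hab|].
intros t ht. destruct (hd t ht). split; [|lra]. now apply @is_derive_opp.
Qed.

Lemma is_derive_RInt_0 (f : R -> R) (t : R) :
  (forall s, continuous f s) -> is_derive (fun t => RInt f 0 t) t (f t).
Proof.
intros hf. apply is_derive_RInt with 0; [|apply hf].
apply filter_forall. intros b. apply (@RInt_correct R_CompleteNormedModule).
apply ex_RInt_continuous. intros; apply hf.
Qed.

(* Since exp u >= (1 + u/2)^2, linear functions are negligible. *)
Lemma exp_dominates_linear (b c A eps : R) :
  0 < c -> 0 < eps -> exists T, b <= T /\ exp (- c * T) * (A + T) <= eps.
Proof.
intros hc he.
(* From [A <= T] one has A + T <= 2T, and 2T <= eps (cT/2)^2 exactly when T >= 8/(c^2 eps), for T >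
   0. *)
set (T := Rmax b (Rmax (Rmax A 0) (8 / (c * c * eps)))).
assert (hT : b <= T /\ A <= T /\ 0 <= T /\ 8 / (c * c * eps) <= T).
{ unfold T. repeat split; unfold Rmax; repeat destruct Rle_dec; lra. }
exists T. split; [lra|].
replace (- c * T) with (- (c * T)) by ring. rewrite exp_Ropp.
assert (hE : (c * T / 2) ^ 2 <= exp (c * T)).
{ replace (c * T) with (c * T / 2 + c * T / 2) at 2 by field. rewrite exp_plus.
  assert (0 <= c * T) by (apply Rmult_le_pos; lra).
  pose proof (exp_ineq1_le (c * T / 2)). nra. }
pose proof (exp_pos (c * T)).
apply Rmult_le_reg_l with (exp (c * T)); [assumption|].
rewrite <- Rmult_assoc, Rinv_r, Rmult_1_l by lra.
assert (hcc : 0 < c * c * eps) by (repeat apply Rmult_lt_0_compat; lra).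
assert (8 <= T * (c * c * eps)).
{ destruct hT as (_ & _ & _ & h). apply Rmult_le_compat_r with (r := c * c * eps) in h; [|lra].
  unfold Rdiv in h. rewrite Rmult_assoc, Rinv_l, Rmult_1_r in h; lra. }
apply Rle_trans with ((c * T / 2) ^ 2 * eps); [|apply Rmult_le_compat_r; lra].
nra.
Qed.

(** * Existence on the half-line *)

Section Profile.

Variables (K a eps : R) (q : R -> R).
Hypothesis hK : 0 <= K.
Hypothesis ha : 0 < a.
Hypothesis heps : 0 < eps <= a.
Hypothesis q_cont : forall x, continuous q x.
Hypothesis q_mono : forall x y, 0 <= x <= y -> q x <= q y.
Hypothesis q_0 : q 0 = 0.
Hypothesis q_a : q a = K * a.
Hypothesis q_small : forall x, 0 <= x <= eps -> (K + 5) * x <= q x.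

(** This size makes [c ^ 2 - / 2 - K] nonnegative, so that [x s] has a nonnegative coefficient in
    [source] for [s >= 0]. *)
Let c := K + 1.

(** The Lipschitz bound, common to all members, survives pointwise suprema and so keeps them
    continuous. *)
Definition admissible (x : R -> R) : Prop :=
  (forall t, 0 <= x t <= a) /\
  (forall s t, Rabs (x s - x t) <= a * (Rabs s + Rabs t + c) * Rabs (s - t)).

Definition source (x : R -> R) (s : R) : R :=
  (c ^ 2 - / 2 - K + c * s / 2) * x s + q (x s).

Definition source_int (x : R -> R) (s : R) : R :=
  RInt (fun r => exp (- c * r) * source x r) 0 s.

(** The improper integral over the half-line, encoded as a supremum of partial integrals because the
    integrand is nonnegative for admissible [x]. *)
Definition source_total (x : R -> R) : R :=
  real (Lub_Rbar (fun v => exists s, 0 <= s /\ v = source_int x s)).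

(* The bounded solution of z' = c z - source x, and then the solution of
   u' = z - (t/2 + c) u, u(0) = 0: together they solve
   u'' + t/2 u' - (c^2 - 1/2 + c t/2) u = - source x. *)
Definition flux (x : R -> R) (s : R) : R :=
  exp (c * s) * (source_total x - source_int x s).

Definition solve (x : R -> R) (t : R) : R :=
  exp (- (t ^ 2 / 4 + c * t)) * RInt (fun s => exp (s ^ 2 / 4 + c * s) * flux x s) 0 t.

Definition step (x : R -> R) (t : R) : R := solve x (Rabs t).

(** * Order and size estimates for the integral operator *)

Lemma c_ge : 1 <= c. Proof. unfold c; lra. Qed.
Lemma c_sq : 0 <= c ^ 2 - / 2 - K. Proof. unfold c; nra. Qed.

Lemma admissible_continuous x t : admissible x -> continuous x t.
Proof.
intros [_ hx]. pose proof c_ge as hc.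
apply continuity_pt_filterlim. intros e he.
set (M := a * (2 * Rabs t + 1 + c)).
assert (hM : 0 < M).
{ apply Rmult_lt_0_compat; [exact ha|]. pose proof (Rabs_pos t). lra. }
exists (Rmin 1 (e / M)). split.
{ apply Rmin_glb_lt; [lra|]. now apply Rdiv_lt_0_compat. }
intros s [_ hs]. simpl in *. unfold R_dist in *.
eapply Rle_lt_trans; [apply hx|].
assert (h1 : Rabs (s - t) < 1) by (eapply Rlt_le_trans; [exact hs|apply Rmin_l]).
assert (h2 : Rabs (s - t) < e / M) by (eapply Rlt_le_trans; [exact hs|apply Rmin_r]).
apply Rle_lt_trans with (M * Rabs (s - t)).
- apply Rmult_le_compat_r; [apply Rabs_pos|].
  unfold M. apply Rmult_le_compat_l; [lra|].
  pose proof (Rabs_triang_inv s t). lra.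
- apply Rmult_lt_compat_l with (r := M) in h2; [|exact hM].
  replace (M * (e / M)) with e in h2 by (field; lra). exact h2.
Qed.

Lemma source_continuous x t : admissible x -> continuous (source x) t.
Proof.
intros hx. pose proof (admissible_continuous x t hx) as hc.
apply @continuous_plus.
- apply @continuous_mult; [|exact hc].
  apply (ex_derive_continuous (fun s => c ^ 2 - / 2 - K + c * s / 2)). auto_derive. exact I.
- apply (continuous_comp x q); [exact hc|apply q_cont].
Qed.

Lemma source_int_derive x t :
  admissible x -> is_derive (source_int x) t (exp (- c * t) * source x t).
Proof.
intros hx. apply (is_derive_RInt_0 (fun r => exp (- c * r) * source x r)).
intros s. apply @continuous_mult; [|now apply source_continuous].
apply (ex_derive_continuous (fun s => exp (- c * s))). auto_derive. exact I.
Qed.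

(** The purpose of the shift by [c]: both summands of [source] are now nondecreasing in the value of
    [x]. *)
Lemma source_mono x y s :
  admissible x -> admissible y -> 0 <= s -> x s <= y s -> source x s <= source y s.
Proof.
intros [hx _] [hy _] hs hxy. unfold source. pose proof c_sq. pose proof c_ge.
apply Rplus_le_compat; [|apply q_mono; split; [apply hx|exact hxy]].
apply Rmult_le_compat_l; [|exact hxy]. nra.
Qed.

Lemma source_nonneg x s : admissible x -> 0 <= s -> 0 <= source x s.
Proof.
intros [hx _] hs. unfold source. pose proof c_sq. pose proof c_ge.
assert (q 0 <= q (x s)) by (apply q_mono; split; [lra|apply hx]).
assert (0 <= (c ^ 2 - / 2 - K + c * s / 2) * x s).
{ apply Rmult_le_pos; [nra|apply hx]. }
lra.
Qed.

(** The bound is the source of the constant [a], where [q a = K * a] cancels the term in -K. *)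
Lemma source_le x s : admissible x -> 0 <= s -> source x s <= a * (c ^ 2 - / 2 + c * s / 2).
Proof.
intros [hx _] hs. unfold source. pose proof c_sq. pose proof c_ge.
assert (q (x s) <= q a) by (apply q_mono; apply hx).
assert ((c ^ 2 - / 2 - K + c * s / 2) * x s <= (c ^ 2 - / 2 - K + c * s / 2) * a).
{ apply Rmult_le_compat_l; [nra|apply hx]. }
lra.
Qed.

Lemma source_int_mono x s t :
  admissible x -> 0 <= s <= t -> source_int x s <= source_int x t.
Proof.
intros hx hst. apply le_of_derive_nonneg with (fun r => exp (- c * r) * source x r); [lra|].
intros r hr. split; [now apply source_int_derive|].
apply Rmult_le_pos; [left; apply exp_pos|apply source_nonneg; [exact hx|lra]].
Qed.

(** The right-hand side is the exact integral over [s, +oo) of exp(-c r) times the bound of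
    [source_le]. *)
Lemma source_int_increment_le x s t :
  admissible x -> 0 <= s <= t ->
  source_int x t - source_int x s <= exp (- c * s) * (a * (s / 2 + c)).
Proof.
intros hx hst. pose proof c_ge.
enough (source_int x t + exp (- c * t) * (a * (t / 2 + c))
        <= source_int x s + exp (- c * s) * (a * (s / 2 + c))).
{ assert (0 <= exp (- c * t) * (a * (t / 2 + c))).
  { apply Rmult_le_pos; [left; apply exp_pos|]. apply Rmult_le_pos; lra. }
  lra. }
apply (le_of_derive_nonpos (fun t => source_int x t + exp (- c * t) * (a * (t / 2 + c)))
  (fun r => exp (- c * r) * (source x r - a * (c ^ 2 - / 2 + c * r / 2)))); [lra|].
intros r hr. split.
- pose proof (source_int_derive x r hx) as hd.
  auto_derive; [ex_derive_by_hyp|].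
  rewrite_derive. field.
- pose proof (source_le x r hx ltac:(lra)). pose proof (exp_pos (- c * r)). nra.
Qed.

Lemma source_int_0 x : source_int x 0 = 0.
Proof. exact (RInt_point 0 _). Qed.

(** The increment bound started at 0 makes the supremum finite, so [real] returns it unchanged. *)
Lemma source_total_lub x :
  admissible x -> is_lub (fun v => exists s, 0 <= s /\ v = source_int x s) (source_total x).
Proof.
intros hx. unfold source_total.
set (P := fun v => _).
destruct (completeness P) as [l hl].
- exists (exp (- c * 0) * (a * (0 / 2 + c))). intros v [s [hs ->]].
  pose proof (source_int_increment_le x 0 s hx ltac:(lra)). rewrite source_int_0 in *. lra.
- exists (source_int x 0), 0. split; [lra|reflexivity].
- replace (Lub_Rbar P) with (Finite l); [exact hl|].
  symmetry. apply is_lub_Rbar_unique. split.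
  + intros v hv. now apply hl.
  + intros [m| |] hm; simpl; auto.
    * apply hl. intros v hv. now apply hm.
    * apply (hm (source_int x 0)). exists 0. split; [lra|reflexivity].
Qed.

Lemma source_int_le_total x s : admissible x -> 0 <= s -> source_int x s <= source_total x.
Proof. intros hx hs. apply (source_total_lub x hx). now exists s. Qed.

Lemma flux_derive x t : admissible x -> is_derive (flux x) t (c * flux x t - source x t).
Proof.
intros hx. pose proof (source_int_derive x t hx) as hd. unfold flux at 1.
auto_derive; [ex_derive_by_hyp|].
rewrite_derive. unfold flux.
replace (exp (- c * t)) with (/ exp (c * t)).
- field. pose proof (exp_pos (c * t)). lra.
- rewrite <- exp_Ropp. f_equal. ring.
Qed.

Lemma flux_nonneg x s : admissible x -> 0 <= s -> 0 <= flux x s.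
Proof.
intros hx hs. apply Rmult_le_pos; [left; apply exp_pos|].
pose proof (source_int_le_total x s hx hs). lra.
Qed.

Lemma exp_c_cancel s v : exp (c * s) * (exp (- c * s) * v) = v.
Proof.
rewrite <- Rmult_assoc, <- exp_plus. replace (c * s + - c * s) with 0 by ring.
rewrite exp_0. ring.
Qed.

Lemma flux_le x s : admissible x -> 0 <= s -> flux x s <= a * (s / 2 + c).
Proof.
intros hx hs. pose proof c_ge.
rewrite <- (exp_c_cancel s (a * (s / 2 + c))). unfold flux.
apply Rmult_le_compat_l; [left; apply exp_pos|].
enough (source_total x <= source_int x s + exp (- c * s) * (a * (s / 2 + c))) by lra.
apply (source_total_lub x hx). intros v [t [ht ->]].
destruct (Rle_dec s t).
- pose proof (source_int_increment_le x s t hx ltac:(lra)). lra.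
- pose proof (source_int_mono x t s hx ltac:(lra)).
  assert (0 <= exp (- c * s) * (a * (s / 2 + c))).
  { apply Rmult_le_pos; [left; apply exp_pos|]. apply Rmult_le_pos; lra. }
  lra.
Qed.

(** The flux is a weighted tail integral of the source, and [source_int y - source_int x] is
    nondecreasing. *)
Lemma flux_mono x y s :
  admissible x -> admissible y -> (forall t, x t <= y t) -> 0 <= s -> flux x s <= flux y s.
Proof.
intros hx hy hxy hs. apply Rmult_le_compat_l; [left; apply exp_pos|].
enough (source_total x <= source_int x s + (source_total y - source_int y s)) by lra.
apply (source_total_lub x hx). intros v [t [ht ->]].
destruct (Rle_dec s t).
- pose proof (source_int_le_total y t hy ht).
  enough (source_int y s - source_int x s <= source_int y t - source_int x t) by lra.
  apply (le_of_derive_nonneg (fun t => source_int y t - source_int x t)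
    (fun r => exp (- c * r) * source y r - exp (- c * r) * source x r)); [lra|].
  intros t' ht'. split.
  + apply @is_derive_minus; now apply source_int_derive.
  + assert (source x t' <= source y t') by (apply source_mono; auto; lra).
    pose proof (exp_pos (- c * t')). nra.
- pose proof (source_int_mono x t s hx ltac:(lra)).
  pose proof (source_int_le_total y s hy hs). lra.
Qed.

Lemma solve_derive x t :
  admissible x -> is_derive (solve x) t (flux x t - (t / 2 + c) * solve x t).
Proof.
intros hx.
assert (hd : is_derive (fun t => RInt (fun s => exp (s ^ 2 / 4 + c * s) * flux x s) 0 t) t
   (exp (t ^ 2 / 4 + c * t) * flux x t)).
{ apply (is_derive_RInt_0 (fun s => exp (s ^ 2 / 4 + c * s) * flux x s)). intros s.
  apply (ex_derive_continuous (fun s => exp (s ^ 2 / 4 + c * s) * flux x s)).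
  pose proof (flux_derive x s hx). auto_derive. ex_derive_by_hyp. }
unfold solve.
set (I := fun t => RInt (fun s => exp (s ^ 2 / 4 + c * s) * flux x s) 0 t) in *.
change (is_derive (fun t => exp (- (t ^ 2 / 4 + c * t)) * I t) t
  (flux x t - (t / 2 + c) * (exp (- (t ^ 2 / 4 + c * t)) * I t))).
auto_derive; [ex_derive_by_hyp|].
rewrite_derive.
replace (t * (t * 1) * / 4 + c * t) with (t ^ 2 / 4 + c * t) by field.
rewrite exp_Ropp. field. pose proof (exp_pos (t ^ 2 / 4 + c * t)). lra.
Qed.

Lemma solve_0 x : solve x 0 = 0.
Proof. unfold solve. rewrite RInt_point. unfold zero; simpl. ring. Qed.

(* Gronwall with integrating factor exp (t^2/4 + c t). *)
Lemma gronwall_nonneg (f df : R -> R) t :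
  0 <= t ->
  (forall s, 0 <= s -> is_derive f s (df s) /\ 0 <= df s + (s / 2 + c) * f s) ->
  f 0 <= exp (t ^ 2 / 4 + c * t) * f t.
Proof.
intros ht hf.
replace (f 0) with (exp (0 ^ 2 / 4 + c * 0) * f 0)
  by (replace (0 ^ 2 / 4 + c * 0) with 0 by field; rewrite exp_0; ring).
apply (le_of_derive_nonneg (fun t => exp (t ^ 2 / 4 + c * t) * f t)
  (fun s => exp (s ^ 2 / 4 + c * s) * (df s + (s / 2 + c) * f s))); [lra|].
intros s hs. destruct (hf s ltac:(lra)) as [hd h0]. split.
- auto_derive; [ex_derive_by_hyp|].
  rewrite_derive.
  replace (s * (s * 1) * / 4 + c * s) with (s ^ 2 / 4 + c * s) by field. field.
- apply Rmult_le_pos; [left; apply exp_pos|exact h0].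
Qed.

(** The constant [a] is a supersolution of the first-order equation by [flux_le]; strictness is
    inherited from the gap [a] at time 0. *)
Lemma solve_lt x t : admissible x -> 0 <= t -> solve x t < a.
Proof.
intros hx ht.
assert (h : a - solve x 0 <= exp (t ^ 2 / 4 + c * t) * (a - solve x t)).
{ apply (gronwall_nonneg (fun t => a - solve x t)
    (fun s => - (flux x s - (s / 2 + c) * solve x s))); [exact ht|].
  intros s hs. split.
  - pose proof (solve_derive x s hx) as hd.
    auto_derive; [ex_derive_by_hyp|]. rewrite_derive. ring.
  - pose proof (flux_le x s hx hs). nra. }
rewrite solve_0 in h. pose proof (exp_pos (t ^ 2 / 4 + c * t)). nra.
Qed.

Lemma solve_mono x y t :
  admissible x -> admissible y -> (forall t, x t <= y t) -> 0 <= t -> solve x t <= solve y t.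
Proof.
intros hx hy hxy ht.
assert (h : solve y 0 - solve x 0 <= exp (t ^ 2 / 4 + c * t) * (solve y t - solve x t)).
{ apply (gronwall_nonneg (fun t => solve y t - solve x t)
    (fun s => (flux y s - (s / 2 + c) * solve y s) - (flux x s - (s / 2 + c) * solve x s)));
    [exact ht|].
  intros s hs. split.
  - apply @is_derive_minus; now apply solve_derive.
  - pose proof (flux_mono x y s hx hy hxy hs). nra. }
rewrite !solve_0 in h. pose proof (exp_pos (t ^ 2 / 4 + c * t)). nra.
Qed.

Lemma solve_nonneg x t : admissible x -> 0 <= t -> 0 <= solve x t.
Proof.
intros hx ht.
assert (h : solve x 0 <= exp (t ^ 2 / 4 + c * t) * solve x t).
{ apply (gronwall_nonneg (solve x) (fun s => flux x s - (s / 2 + c) * solve x s)); [exact ht|].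
  intros s hs. split; [now apply solve_derive|].
  pose proof (flux_nonneg x s hx hs). nra. }
rewrite solve_0 in h. pose proof (exp_pos (t ^ 2 / 4 + c * t)). nra.
Qed.

(** Both [flux x r] and [(r / 2 + c) * solve x r] lie in [0, a (r/2 + c)], hence so does the
    absolute value of their difference, the derivative. *)
Lemma solve_lipschitz x s t :
  admissible x -> 0 <= s <= t -> Rabs (solve x s - solve x t) <= a * (s + t + c) * (t - s).
Proof.
intros hx hst. pose proof c_ge.
destruct (MVT_gen (solve x) s t (fun t => flux x t - (t / 2 + c) * solve x t))
  as [r [hr he]].
- intros; now apply solve_derive.
- intros r _. eapply continuity_pt_of_derive. now apply solve_derive.
- rewrite Rmin_left, Rmax_right in hr by lra.
  rewrite Rabs_minus_sym, he, Rabs_mult, (Rabs_right (t - s)) by lra.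
  apply Rmult_le_compat_r; [lra|].
  pose proof (flux_nonneg x r hx ltac:(lra)). pose proof (flux_le x r hx ltac:(lra)).
  pose proof (solve_nonneg x r hx ltac:(lra)). pose proof (solve_lt x r hx ltac:(lra)).
  assert (a * (r / 2 + c) <= a * (s + t + c)) by (apply Rmult_le_compat_l; lra).
  apply Rabs_le. nra.
Qed.

Lemma step_admissible x : admissible x -> admissible (step x).
Proof.
intros hx. pose proof c_ge. unfold step. split.
- intros t. pose proof (Rabs_pos t). split; [now apply solve_nonneg|left; now apply solve_lt].
- intros s t.
  pose proof (Rabs_pos s). pose proof (Rabs_pos t).
  assert (0 <= a * (Rabs s + Rabs t + c)) by (apply Rmult_le_pos; lra).
  destruct (Rle_dec (Rabs s) (Rabs t)).
  + eapply Rle_trans; [apply solve_lipschitz; [exact hx|lra]|].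
    apply Rmult_le_compat_l; [assumption|].
    rewrite (Rabs_minus_sym s t). apply Rabs_triang_inv.
  + rewrite Rabs_minus_sym.
    eapply Rle_trans; [apply solve_lipschitz; [exact hx|lra]|].
    rewrite (Rplus_comm (Rabs t)). apply Rmult_le_compat_l; [assumption|].
    apply Rabs_triang_inv.
Qed.

(** * The subsolution and the fixed point above it *)

Definition subsol (t : R) : R := eps * (t ^ 2 / (1 + t ^ 2)).

Lemma subsol_range t : 0 <= subsol t <= eps.
Proof.
assert (0 <= t ^ 2 / (1 + t ^ 2) <= 1).
{ pose proof (pow2_ge_0 t). split.
  - apply Rmult_le_pos; [lra|]. left; apply Rinv_0_lt_compat; lra.
  - apply Rmult_le_reg_r with (1 + t ^ 2); [lra|].
    unfold Rdiv. rewrite Rmult_assoc, Rinv_l; lra. }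
unfold subsol. nra.
Qed.

Lemma subsol_admissible : admissible subsol.
Proof.
pose proof c_ge. split.
- intros t. pose proof (subsol_range t). lra.
- intros s t. pose proof (pow2_ge_0 s). pose proof (pow2_ge_0 t).
  replace (subsol s - subsol t)
    with (eps * (/ ((1 + s ^ 2) * (1 + t ^ 2))) * ((s + t) * (s - t)))
    by (unfold subsol; field; split; lra).
  rewrite !Rabs_mult.
  assert (h1 : 0 < / ((1 + s ^ 2) * (1 + t ^ 2)) <= 1).
  { split; [apply Rinv_0_lt_compat; nra|]. rewrite <- Rinv_1. apply Rinv_le_contravar; nra. }
  rewrite (Rabs_right eps), (Rabs_right (/ _)) by lra.
  rewrite <- Rmult_assoc. apply Rmult_le_compat_r; [apply Rabs_pos|].
  pose proof (Rabs_pos s). pose proof (Rabs_pos t).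
  apply Rmult_le_compat; [nra|apply Rabs_pos|nra|].
  pose proof (Rabs_triang s t). lra.
Qed.

Let dsubsol t := eps * (2 * t / (1 + t ^ 2) ^ 2).
Let ddsubsol t := eps * ((2 - 6 * t ^ 2) / (1 + t ^ 2) ^ 3).

Lemma subsol_derive t : is_derive subsol t (dsubsol t).
Proof.
unfold subsol, dsubsol. pose proof (pow2_ge_0 t).
auto_derive; [lra|]. field. lra.
Qed.

Lemma dsubsol_derive t : is_derive dsubsol t (ddsubsol t).
Proof.
unfold ddsubsol, dsubsol. pose proof (pow2_ge_0 t).
auto_derive; [apply Rgt_not_eq; nra|]. field. nra.
Qed.

(** The 5 of [q_small] exactly cancels the t^2 coefficient of the numerator, leaving 2 + 11 t^4 + 5
    t^6. *)
Lemma subsol_ineq t :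
  K * subsol t - q (subsol t) <= ddsubsol t + t / 2 * dsubsol t.
Proof.
pose proof (pow2_ge_0 t).
apply Rle_trans with (-5 * subsol t).
{ pose proof (q_small _ (subsol_range t)). lra. }
enough (0 <= ddsubsol t + t / 2 * dsubsol t + 5 * subsol t) by lra.
unfold subsol, dsubsol, ddsubsol.
replace (eps * ((2 - 6 * t ^ 2) / (1 + t ^ 2) ^ 3) + t / 2 * (eps * (2 * t / (1 + t ^ 2) ^ 2)) +
   5 * (eps * (t ^ 2 / (1 + t ^ 2))))
  with (eps * (2 + 11 * t ^ 4 + 5 * t ^ 6) / (1 + t ^ 2) ^ 3) by (field; lra).
assert (0 <= t ^ 4) by (replace (t ^ 4) with ((t ^ 2) ^ 2) by ring; apply pow2_ge_0).
assert (0 <= t ^ 6) by (replace (t ^ 6) with ((t ^ 3) ^ 2) by ring; apply pow2_ge_0).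
apply Rmult_le_pos; [nra|]. left. apply Rinv_0_lt_compat, pow_lt. lra.
Qed.

(** By [subsol_ineq], exp(-c t) w(t) plus [source_int subsol t] is nondecreasing for the left-hand
    side w; as t grows, the first term vanishes and the second stays below [source_total]. *)
Lemma subsol_flux s : 0 <= s -> dsubsol s + (s / 2 + c) * subsol s <= flux subsol s.
Proof.
intros hs. pose proof c_ge as hc.
set (w := fun s => dsubsol s + (s / 2 + c) * subsol s).
pose proof subsol_admissible as hadm.
change (w s <= flux subsol s).
rewrite <- (exp_c_cancel s (w s)). unfold flux.
apply Rmult_le_compat_l; [left; apply exp_pos|].
assert (hw : forall t, s <= t ->
  exp (- c * s) * w s <= source_total subsol - source_int subsol s + exp (- c * t) * w t).
{ intros t ht. pose proof (source_int_le_total subsol t hadm ltac:(lra)).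
  enough (source_int subsol s + exp (- c * s) * w s
          <= source_int subsol t + exp (- c * t) * w t) by lra.
  apply (le_of_derive_nonneg (fun t => source_int subsol t + exp (- c * t) * w t)
    (fun r => exp (- c * r) *
       (ddsubsol r + r / 2 * dsubsol r - (K * subsol r - q (subsol r))))); [lra|].
  intros r hr. split.
  - pose proof (source_int_derive subsol r hadm) as h1.
    pose proof (subsol_derive r) as h2. pose proof (dsubsol_derive r) as h3.
    unfold w. auto_derive; [ex_derive_by_hyp|].
    rewrite_derive.
    unfold source. field.
  - apply Rmult_le_pos; [left; apply exp_pos|]. pose proof (subsol_ineq r). lra. }
apply Rnot_lt_le. intros hlt.
(* The supposed gap is [4 * eps * d], while at a suitable [t] the remainder exp(-c t) w(t) is at
   most [3 * eps * d]. *)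
set (d := (exp (- c * s) * w s - (source_total subsol - source_int subsol s)) / (4 * eps)).
assert (hd : 0 < d) by (apply Rdiv_lt_0_compat; lra).
destruct (exp_dominates_linear s c (2 * c) d) as [t [ht hbd]]; [lra|exact hd|].
specialize (hw t ht).
assert (hwt : w t <= 3 * eps * (2 * c + t)).
{ unfold w. pose proof (subsol_range t).
  assert (dsubsol t <= 2 * t * eps).
  { unfold dsubsol. pose proof (pow2_ge_0 t).
    assert (2 * t / (1 + t ^ 2) ^ 2 <= 2 * t); [|nra].
    apply Rmult_le_reg_r with ((1 + t ^ 2) ^ 2); [apply pow_lt; lra|].
    unfold Rdiv. rewrite Rmult_assoc, Rinv_l, Rmult_1_r by (apply pow_nonzero; lra).
    assert (1 <= (1 + t ^ 2) ^ 2) by nra. nra. }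
  assert ((t / 2 + c) * subsol t <= (t / 2 + c) * eps) by (apply Rmult_le_compat_l; lra).
  assert (0 <= eps * t) by nra. assert (0 <= eps * c) by nra. lra. }
pose proof (exp_pos (- c * t)).
assert (exp (- c * t) * w t <= 3 * eps * (exp (- c * t) * (2 * c + t))) by nra.
assert (3 * eps * (exp (- c * t) * (2 * c + t)) <= 3 * eps * d) by nra.
assert (4 * eps * d = exp (- c * s) * w s - (source_total subsol - source_int subsol s))
  by (unfold d; field; lra).
lra.
Qed.

(** Gives a nonzero starting point for the fixed-point argument; since [q 0 = 0], the zero function
    is itself a fixed point and must be avoided. *)
Lemma subsol_le_step t : subsol t <= step subsol t.
Proof.
unfold step.
replace (subsol t) with (subsol (Rabs t)) by (unfold subsol; now rewrite pow2_abs).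
pose proof (Rabs_pos t) as ht. set (u := Rabs t) in *.
assert (h : solve subsol 0 - subsol 0 <= exp (u ^ 2 / 4 + c * u) * (solve subsol u - subsol u)).
{ apply (gronwall_nonneg (fun t => solve subsol t - subsol t)
    (fun s => (flux subsol s - (s / 2 + c) * solve subsol s) - dsubsol s)); [exact ht|].
  intros s hs. split.
  - apply @is_derive_minus; [apply solve_derive, subsol_admissible|apply subsol_derive].
  - pose proof (subsol_flux s hs). nra. }
rewrite solve_0 in h. replace (subsol 0) with 0 in h by (unfold subsol; field).
pose proof (exp_pos (u ^ 2 / 4 + c * u)). nra.
Qed.

(* Knaster-Tarski: the supremum of the admissible x with x <= step x is a fixed point. *)
Lemma step_fixpoint :
  exists x, admissible x /\ (forall t, subsol t <= x t) /\ (forall t, x t = step x t).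
Proof.
pose proof c_ge as hc.
set (below := fun x => admissible x /\ forall t, x t <= step x t).
assert (hsub : below subsol) by (split; [apply subsol_admissible|apply subsol_le_step]).
assert (hsup : forall t, { m | is_lub (fun v => exists x, below x /\ v = x t) m }).
{ intros t. apply completeness.
  - exists a. intros v [x [[[hx _] _] ->]]. apply hx.
  - exists (subsol t), subsol. now split. }
set (X := fun t => proj1_sig (hsup t)).
assert (hX : forall t, is_lub (fun v => exists x, below x /\ v = x t) (X t))
  by (intros t; exact (proj2_sig (hsup t))).
assert (hle : forall x t, below x -> x t <= X t) by (intros x t hx; apply hX; now exists x).
assert (hadm : admissible X).
{ split.
  - intros t. split.
    + apply Rle_trans with (subsol t); [apply subsol_range|now apply hle].
    + apply hX. intros v [x [[[hx _] _] ->]]. apply hx.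
  (* The one-sided bound passes to the supremum; exchanging [s] and [t] gives the other side. *)
  - assert (hone : forall s t, X s - X t <= a * (Rabs s + Rabs t + c) * Rabs (s - t)).
    { intros s t.
      enough (X s <= X t + a * (Rabs s + Rabs t + c) * Rabs (s - t)) by lra.
      apply hX. intros v [x [hx ->]]. pose proof (hle x t hx).
      destruct hx as [[_ hx] _]. specialize (hx s t).
      pose proof (Rle_abs (x s - x t)). lra. }
    intros s t. apply Rabs_le. pose proof (hone s t). pose proof (hone t s) as h.
    rewrite (Rplus_comm (Rabs t)), (Rabs_minus_sym t s) in h. lra. }
assert (hXs : forall t, X t <= step X t).
{ intros t. apply hX. intros v [x [hx ->]].
  apply Rle_trans with (step x t); [apply hx|].
  apply solve_mono; [apply hx|exact hadm| |apply Rabs_pos]. intros s. now apply hle. }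
exists X. split; [exact hadm|]. split; [intros t; now apply hle|].
intros t. apply Rle_antisym; [apply hXs|].
(* By monotonicity [step X] belongs to [below], so it cannot exceed the supremum [X]. *)
apply hle. split; [now apply step_admissible|].
intros s. apply solve_mono; [exact hadm|now apply step_admissible|exact hXs|apply Rabs_pos].
Qed.

(** At a fixed point the shift on both sides cancels and the original equation remains; the floor
    [eps / 2] is the value of [subsol] at 1. *)
Lemma half_line_profile :
  exists U Y : R -> R,
    U 0 = 0 /\
    (forall t, is_derive U t (Y t)) /\
    (forall t, 0 <= t -> is_derive Y t (K * U t - q (U t) - / 2 * t * Y t)) /\
    (forall t, 0 <= t -> 0 <= U t < a) /\
    (forall t, 1 <= t -> eps / 2 <= U t).
Proof.
destruct step_fixpoint as (x & hx & hsub & hfix).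
assert (hUx : forall t, 0 <= t -> x t = solve x t).
{ intros t ht. rewrite hfix. unfold step. now rewrite Rabs_right by lra. }
(* [solve x] agrees with [x] for [t >= 0] and, unlike the even function [x], has its derivative
   given by one formula on both sides of 0. *)
exists (solve x), (fun t => flux x t - (t / 2 + c) * solve x t).
split; [apply solve_0|]. split; [intros t; now apply solve_derive|]. split; [|split].
- intros t ht. pose proof (flux_derive x t hx) as h1. pose proof (solve_derive x t hx) as h2.
  auto_derive; [ex_derive_by_hyp|].
  rewrite_derive.
  unfold source. rewrite (hUx t ht). field.
- intros t ht. split; [now apply solve_nonneg|now apply solve_lt].
- intros t ht. rewrite <- hUx by lra. apply Rle_trans with (subsol t); [|apply hsub].
  unfold subsol. assert (/ 2 <= t ^ 2 / (1 + t ^ 2)); [|nra].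
  assert (1 <= t ^ 2) by nra.
  apply Rmult_le_reg_r with (1 + t ^ 2); [lra|].
  unfold Rdiv. rewrite Rmult_assoc, Rinv_l; lra.
Qed.

End Profile.

(** * Monotonicity, limits and slope bounds *)

Section Asymptotics.

Variables (K a e m : R) (q F U Y : R -> R).
Let h x := K * x - q x.
Hypothesis he : 0 < e.
Hypothesis hm : m <= 0.
Hypothesis h_bounds : forall x, 0 <= x <= a -> m <= h x <= 0.
Hypothesis h_gap :
  forall b, e <= b < a -> exists d, 0 < d /\ forall x, e <= x <= b -> h x <= - d.
Hypothesis F_cont : forall x, continuity_pt F x.
Hypothesis F_derive : forall x, 0 < x -> is_derive F x (h x).
Hypothesis U_0 : U 0 = 0.
Hypothesis U_derive : forall t, is_derive U t (Y t).
Hypothesis Y_derive : forall t, 0 <= t -> is_derive Y t (K * U t - q (U t) - / 2 * t * Y t).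
Hypothesis U_range : forall t, 0 <= t -> 0 <= U t < a.
Hypothesis U_ge : forall t, 1 <= t -> e <= U t.

Lemma U_h_bounds t : 0 <= t -> m <= K * U t - q (U t) <= 0.
Proof. intros ht. apply h_bounds. pose proof (U_range t ht). lra. Qed.

(* If U stayed below b < a, then Y' <= -d - tY/2 would force Y to be of order -1/t,
   which is not integrable; the function P makes this precise. *)
Lemma U_not_eventually_le b t1 :
  b < a -> 1 <= t1 -> ~ (forall t, t1 <= t -> U t <= b).
Proof.
intros hb ht1 hU.
assert (heb : e <= b) by (pose proof (U_ge t1 ht1); pose proof (hU t1 ltac:(lra)); lra).
destruct (h_gap b (conj heb hb)) as (d & hd & hgap).
(* The first entry makes exp(t^2/4) (Y + B) nondecreasing for t >= 1, the second makes it
   nonnegative at 1. *)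
set (B := Rmax (-2 * m) (- Y 1)).
assert (hB : -2 * m <= B /\ - Y 1 <= B) by (split; [apply Rmax_l|apply Rmax_r]).
assert (hYB : forall t, 1 <= t -> 0 <= Y t + B).
{ intros t ht.
  assert (hexp : exp (1 ^ 2 / 4) * (Y 1 + B) <= exp (t ^ 2 / 4) * (Y t + B)).
  { apply (le_of_derive_nonneg (fun t => exp (t ^ 2 / 4) * (Y t + B))
      (fun t => exp (t ^ 2 / 4) * (K * U t - q (U t) + t / 2 * B))); [lra|].
    intros s hs. pose proof (Y_derive s ltac:(lra)) as hY. split.
    - auto_derive; [ex_derive_by_hyp|]. rewrite_derive.
      replace (s * (s * 1) * / 4) with (s ^ 2 / 4) by field. field.
    - apply Rmult_le_pos; [left; apply exp_pos|].
      pose proof (U_h_bounds s ltac:(lra)). nra. }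
  pose proof (exp_pos (1 ^ 2 / 4)). pose proof (exp_pos (t ^ 2 / 4)).
  assert (0 <= exp (1 ^ 2 / 4) * (Y 1 + B)) by (apply Rmult_le_pos; lra). nra. }
(* In P' the term Y cancels against the damping inside 2 Y'/t; the rest is nonpositive since h(U) <=
   -d and Y + B >= 0. *)
set (P := fun t => U t + 2 * (Y t + B) / t + 2 * d * ln t).
assert (hP : forall t, t1 <= t -> P t <= P t1).
{ intros t ht.
  apply (le_of_derive_nonpos P (fun t =>
    2 * (K * U t - q (U t) + d) / t - 2 * (Y t + B) / t ^ 2)); [lra|].
  intros s hs. pose proof (Y_derive s ltac:(lra)) as hY. pose proof (U_derive s) as hUs. split.
  - unfold P. auto_derive; [ex_derive_by_hyp; lra|]. rewrite_derive. field. lra.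
  - assert (K * U s - q (U s) <= - d).
    { apply hgap. split; [apply U_ge; lra|apply hU; lra]. }
    pose proof (hYB s ltac:(lra)).
    assert (0 < / s) by (apply Rinv_0_lt_compat; lra).
    assert (0 < / s ^ 2) by (apply Rinv_0_lt_compat, pow_lt; lra).
    unfold Rdiv. nra. }
(* At this time the logarithm alone exceeds [P t1], while the other two terms of [P t] are
   nonnegative. *)
set (t := Rmax t1 (exp (P t1 / (2 * d) + 1))).
assert (ht : t1 <= t /\ exp (P t1 / (2 * d) + 1) <= t) by (split; [apply Rmax_l|apply Rmax_r]).
assert (hln : P t1 / (2 * d) + 1 <= ln t).
{ rewrite <- (ln_exp (P t1 / (2 * d) + 1)). apply ln_le; [apply exp_pos|lra]. }
assert (2 * d * (P t1 / (2 * d) + 1) <= 2 * d * ln t) by (apply Rmult_le_compat_l; lra).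
replace (2 * d * (P t1 / (2 * d) + 1)) with (P t1 + 2 * d) in * by (field; lra).
pose proof (hP t ltac:(lra)) as h1. unfold P at 1 in h1.
pose proof (U_range t ltac:(lra)).
assert (0 <= 2 * (Y t + B) / t).
{ apply Rmult_le_pos; [pose proof (hYB t ltac:(lra)); lra|].
  left; apply Rinv_0_lt_compat; lra. }
lra.
Qed.

(** Since h <= 0, exp(t^2/4) Y is nonincreasing: once Y <= 0 it stays so, and [U] is trapped below a
    value less than [a]. *)
Lemma Y_pos t : 0 <= t -> 0 < Y t.
Proof.
intros ht. apply Rnot_le_lt. intros hY0.
assert (hneg : forall s, t <= s -> Y s <= 0).
{ intros s hs.
  assert (exp (s ^ 2 / 4) * Y s <= exp (t ^ 2 / 4) * Y t).
  { apply (le_of_derive_nonpos (fun t => exp (t ^ 2 / 4) * Y t)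
      (fun t => exp (t ^ 2 / 4) * (K * U t - q (U t)))); [lra|].
    intros r hr. pose proof (Y_derive r ltac:(lra)) as hY. split.
    - auto_derive; [ex_derive_by_hyp|]. rewrite_derive.
      replace (r * (r * 1) * / 4) with (r ^ 2 / 4) by field. field.
    - pose proof (U_h_bounds r ltac:(lra)). pose proof (exp_pos (r ^ 2 / 4)). nra. }
  pose proof (exp_pos (s ^ 2 / 4)). pose proof (exp_pos (t ^ 2 / 4)). nra. }
apply (U_not_eventually_le (U t) (Rmax 1 t)); [now apply U_range|apply Rmax_l|].
intros s hs. assert (t <= s) by (eapply Rle_trans; [apply Rmax_r|exact hs]).
apply (le_of_derive_nonpos U Y); [lra|].
intros r hr. split; [apply U_derive|apply hneg; lra].
Qed.

Lemma Y_le s t : 0 <= s <= t -> Y t <= Y s.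
Proof.
intros hst. apply (le_of_derive_nonpos Y (fun t => K * U t - q (U t) - / 2 * t * Y t)); [lra|].
intros r hr. split; [apply Y_derive; lra|].
pose proof (U_h_bounds r ltac:(lra)). pose proof (Y_pos r ltac:(lra)). nra.
Qed.

(** Concavity with U(0) = 0: the derivative of U - tY is -tY', which is nonnegative. *)
Lemma Y_le_slope t : 0 <= t -> t * Y t <= U t.
Proof.
intros ht.
enough (U 0 - 0 * Y 0 <= U t - t * Y t) by lra.
apply (le_of_derive_nonneg (fun t => U t - t * Y t)
  (fun t => - (t * (K * U t - q (U t) - / 2 * t * Y t)))); [lra|].
intros r hr. pose proof (Y_derive r ltac:(lra)) as hY. pose proof (U_derive r) as hU. split.
- auto_derive; [ex_derive_by_hyp|]. rewrite_derive. field.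
- pose proof (U_h_bounds r ltac:(lra)). pose proof (Y_pos r ltac:(lra)).
  assert (0 <= r * Y r) by (apply Rmult_le_pos; lra). nra.
Qed.

Lemma U_lim : is_lim U p_infty a.
Proof.
apply is_lim_spec. intros [d hd]. simpl.
destruct (classic (exists t, 1 <= t /\ a - d < U t)) as [[t1 [ht1 hU1]]|hno].
- exists t1. intros t ht. pose proof (U_range t ltac:(lra)).
  assert (U t1 <= U t).
  { apply (le_of_derive_nonneg U Y); [lra|].
    intros r hr. split; [apply U_derive|]. left. apply Y_pos. lra. }
  apply Rabs_def1; lra.
- exfalso. apply (U_not_eventually_le (a - d) 1); [lra|lra|].
  intros t ht. apply Rnot_lt_le. intros hlt. apply hno. now exists t.
Qed.

(** Squeeze: 0 < Y <= U/t < a/t. *)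
Lemma Y_lim : is_lim Y p_infty 0.
Proof.
apply is_lim_spec. intros [d hd]. simpl.
exists (Rmax 0 (a / d)). intros t ht.
assert (ht0 : 0 < t /\ a / d < t).
{ split; (eapply Rle_lt_trans; [|exact ht]); [apply Rmax_l|apply Rmax_r]. }
pose proof (Y_pos t ltac:(lra)). pose proof (Y_le_slope t ltac:(lra)).
pose proof (U_range t ltac:(lra)).
assert (a < d * t).
{ replace a with (d * (a / d)) by (field; lra). apply Rmult_lt_compat_l; lra. }
rewrite Rminus_0_r, Rabs_right by lra. nra.
Qed.

(* The energy Y^2/2 - F(U) is nonincreasing. *)
Lemma slope_lower : 2 * (F 0 - F a) <= Y 0 ^ 2.
Proof.
assert (hE : forall t, 0 <= t -> F 0 - Y 0 ^ 2 / 2 <= F (U t)).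
{ intros t ht.
  enough (F (U 0) - Y 0 ^ 2 / 2 <= F (U t) - Y t ^ 2 / 2).
  { rewrite U_0 in *. pose proof (pow2_ge_0 (Y t)). lra. }
  (* At time 0 the profile is at 0, where [F] is only assumed continuous, hence the open-interval
     version. *)
  apply (le_of_derive_nonneg_open (fun t => F (U t) - Y t ^ 2 / 2)
    (fun t => t * Y t ^ 2 / 2)); [exact ht| |].
  - intros s hs. pose proof (Y_derive s ltac:(lra)) as hY. pose proof (U_derive s) as hU.
    pose proof (Y_pos s ltac:(lra)). pose proof (Y_le_slope s ltac:(lra)).
    pose proof (F_derive (U s) ltac:(nra)) as hF. split.
    + auto_derive; [ex_derive_by_hyp|]. rewrite_derive. unfold h. field.
    + pose proof (pow2_ge_0 (Y s)). nra.
  - intros s hs.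
    apply (continuity_pt_minus (fun t => F (U t)) (fun t => Y t ^ 2 / 2)).
    + apply (continuity_pt_comp U F); [|apply F_cont].
      eapply continuity_pt_of_derive, U_derive.
    + pose proof (Y_derive s ltac:(lra)) as hY.
      apply continuity_pt_filterlim, (ex_derive_continuous (fun t => Y t ^ 2 / 2)).
      auto_derive. ex_derive_by_hyp. }
enough (F 0 - Y 0 ^ 2 / 2 <= F a) by lra.
apply (is_lim_le_loc (fun _ => F 0 - Y 0 ^ 2 / 2) (fun t => F (U t)) p_infty
  (F 0 - Y 0 ^ 2 / 2) (F a)).
- exists 0. intros t ht. apply hE. lra.
- apply is_lim_const.
- apply (is_lim_comp_continuous U F p_infty a); [apply U_lim|].
  apply continuity_pt_filterlim, F_cont.
Qed.

(* Concavity gives t Y <= U, so Y' >= m - U/2 and Y^2/2 - m U + U^2/4 is nondecreasing. *)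
Lemma slope_upper : Y 0 ^ 2 <= a ^ 2 / 2 - 2 * m * a.
Proof.
assert (hQ : forall t, 0 <= t -> Y 0 ^ 2 / 2 <= Y t ^ 2 / 2 + (a ^ 2 / 4 - m * a)).
{ intros t ht. pose proof (U_range t ht).
  apply Rle_trans with (Y t ^ 2 / 2 - m * U t + U t ^ 2 / 4); [|nra].
  replace (Y 0 ^ 2 / 2) with (Y 0 ^ 2 / 2 - m * U 0 + U 0 ^ 2 / 4) by (rewrite U_0; field).
  apply (le_of_derive_nonneg (fun t => Y t ^ 2 / 2 - m * U t + U t ^ 2 / 4)
    (fun t => Y t * (K * U t - q (U t) - m + (U t - t * Y t) / 2))); [exact ht|].
  intros s hs. pose proof (Y_derive s ltac:(lra)) as hY. pose proof (U_derive s) as hU. split.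
  - auto_derive; [ex_derive_by_hyp|]. rewrite_derive. field.
  - pose proof (Y_pos s ltac:(lra)). pose proof (Y_le_slope s ltac:(lra)).
    pose proof (U_h_bounds s ltac:(lra)). apply Rmult_le_pos; lra. }
enough (Y 0 ^ 2 / 2 <= 0 ^ 2 / 2 + (a ^ 2 / 4 - m * a)) by lra.
apply (is_lim_le_loc (fun _ => Y 0 ^ 2 / 2) (fun t => Y t ^ 2 / 2 + (a ^ 2 / 4 - m * a)) p_infty
  (Y 0 ^ 2 / 2) (0 ^ 2 / 2 + (a ^ 2 / 4 - m * a))).
- exists 0. intros t ht. apply hQ. lra.
- apply is_lim_const.
- apply (is_lim_comp_continuous Y (fun y => y ^ 2 / 2 + (a ^ 2 / 4 - m * a)) p_infty 0);
    [apply Y_lim|].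
  apply (ex_derive_continuous (fun y => y ^ 2 / 2 + (a ^ 2 / 4 - m * a))). now auto_derive.
Qed.

End Asymptotics.

(** * Gluing two half-lines at the origin, and regularity *)

Lemma is_derive_glue (f g df dg : R -> R) :
  (forall t, 0 <= t -> is_derive f t (df t)) ->
  (forall t, t <= 0 -> is_derive g t (dg t)) ->
  f 0 = g 0 -> df 0 = dg 0 ->
  forall t, is_derive (fun t => if Rle_dec 0 t then f t else g t) t
    (if Rle_dec 0 t then df t else dg t).
Proof.
intros hf hg h0 hd0 t. destruct (Rtotal_order t 0) as [ht|[->|ht]].
- destruct (Rle_dec 0 t); [lra|].
  apply (is_derive_ext_loc g); [|apply hg; lra].
  generalize (open_lt 0 t ht). apply filter_imp. intros s hs.
  destruct (Rle_dec 0 s); [lra|reflexivity].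
- destruct (Rle_dec 0 0); [|lra].
  (* The difference quotient at 0 is that of [f] for k >= 0 and that of [g] for k < 0; the smaller
     radius serves both. *)
  pose proof (proj1 (is_derive_Reals _ _ _) (hf 0 ltac:(lra))) as h1.
  pose proof (proj1 (is_derive_Reals _ _ _) (hg 0 ltac:(lra))) as h2.
  apply is_derive_Reals. intros eps heps.
  destruct (h1 eps heps) as [d1 hd1]. destruct (h2 eps heps) as [d2 hd2].
  assert (hmin : 0 < Rmin d1 d2) by (apply Rmin_glb_lt; [apply d1|apply d2]).
  exists (mkposreal _ hmin). intros k hk hkd. simpl in hkd.
  destruct (Rle_dec 0 0); [|lra]. destruct (Rle_dec 0 (0 + k)).
  + apply hd1; [exact hk|]. eapply Rlt_le_trans; [exact hkd|apply Rmin_l].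
  + rewrite h0, hd0. apply hd2; [exact hk|]. eapply Rlt_le_trans; [exact hkd|apply Rmin_r].
- destruct (Rle_dec 0 t); [|lra].
  apply (is_derive_ext_loc f); [|apply hf; lra].
  generalize (open_gt 0 t ht). apply filter_imp. intros s hs.
  destruct (Rle_dec 0 s); [reflexivity|lra].
Qed.

Lemma C1_of_derive (f df : R -> R) :
  (forall t, is_derive f t (df t)) -> (forall t, continuous df t) -> Defs.C1 f.
Proof.
intros hf hdf. split; intros t.
- now exists (df t).
- apply (continuous_ext df); [|apply hdf].
  intros s. symmetry. now apply is_derive_unique.
Qed.

(** * The nonlinearity *)

Section SignedPow.

Variable p : R.
Hypothesis hp : 0 < p < 1.
Let K := / (1 - p).
Let a := xstar p.

Lemma signed_pow_0 : signed_pow p 0 = 0.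
Proof. unfold signed_pow. ring. Qed.

Lemma signed_pow_opp x : signed_pow p (- x) = - signed_pow p x.
Proof. unfold signed_pow. rewrite Rabs_Ropp. ring. Qed.

Lemma signed_pow_of_pos x : 0 < x -> signed_pow p x = x * Rpower x (p - 1).
Proof. intros hx. unfold signed_pow. now rewrite Rabs_right by lra. Qed.

Lemma signed_pow_Rpower x : 0 < x -> signed_pow p x = Rpower x p.
Proof.
intros hx. rewrite signed_pow_of_pos by exact hx.
rewrite <- (Rpower_1 x hx) at 1. rewrite <- Rpower_plus. f_equal. ring.
Qed.

Lemma Rabs_signed_pow x : Rabs (signed_pow p x) = signed_pow p (Rabs x).
Proof.
unfold signed_pow. rewrite Rabs_mult, Rabs_Rabsolu. f_equal.
apply Rabs_right. left. apply exp_pos.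
Qed.

Lemma signed_pow_derive x : 0 < x -> is_derive (signed_pow p) x (p * Rpower x (p - 1)).
Proof.
intros hx. apply (is_derive_ext_loc (fun x => Rpower x p)).
- generalize (open_gt 0 x hx). apply filter_imp. intros y hy.
  symmetry. now apply signed_pow_Rpower.
- apply is_derive_Reals. now apply derivable_pt_lim_power.
Qed.

Lemma signed_pow_continuous x : continuous (signed_pow p) x.
Proof.
destruct (Rtotal_order x 0) as [hx|[->|hx]].
- apply (continuous_ext (fun x => - signed_pow p (- x))).
  { intros y. rewrite signed_pow_opp. apply Ropp_involutive. }
  apply (ex_derive_continuous (fun x => - signed_pow p (- x))).
  pose proof (signed_pow_derive (- x) ltac:(lra)) as hd.
  auto_derive. ex_derive_by_hyp.
(* If 0 < |y| < e^(1/p) then |y|^p < e; the point y = 0 is treated apart because of the default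
   value of [Rpower]. *)
- apply continuity_pt_filterlim. intros e he. exists (Rpower e (/ p)).
  split; [apply exp_pos|]. intros y [_ hy]. simpl in *. unfold R_dist in *.
  rewrite signed_pow_0, Rminus_0_r in *. rewrite Rabs_signed_pow.
  destruct (Req_dec y 0) as [->|hy0].
  + rewrite Rabs_R0, signed_pow_0. exact he.
  + pose proof (Rabs_pos_lt y hy0). rewrite signed_pow_Rpower by assumption.
    replace e with (Rpower (Rpower e (/ p)) p).
    * apply Rlt_Rpower_l; lra.
    * rewrite Rpower_mult, Rinv_l, Rpower_1; lra.
- apply (ex_derive_continuous (signed_pow p)). eexists. now apply signed_pow_derive.
Qed.

Lemma signed_pow_nonneg x : 0 <= x -> 0 <= signed_pow p x.
Proof. intros hx. apply Rmult_le_pos; [exact hx|left; apply exp_pos]. Qed.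

Lemma signed_pow_mono x y : 0 <= x <= y -> signed_pow p x <= signed_pow p y.
Proof.
intros hxy. destruct (Req_dec x 0) as [->|hx].
- rewrite signed_pow_0. apply signed_pow_nonneg. lra.
- rewrite !signed_pow_Rpower by lra. apply Rle_Rpower_l; lra.
Qed.

Lemma Rpower_p1_antitone x y : 0 < x <= y -> Rpower y (p - 1) <= Rpower x (p - 1).
Proof.
intros hxy. replace (p - 1) with (- (1 - p)) by ring. rewrite !Rpower_Ropp.
apply Rinv_le_contravar; [apply exp_pos|apply Rle_Rpower_l; lra].
Qed.

Lemma Rpower_p1_strict_antitone x y : 0 < x < y -> Rpower y (p - 1) < Rpower x (p - 1).
Proof.
intros hxy. replace (p - 1) with (- (1 - p)) by ring. rewrite !Rpower_Ropp.
apply Rinv_lt_contravar; [apply Rmult_lt_0_compat; apply exp_pos|apply Rlt_Rpower_l; lra].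
Qed.

Lemma xstar_pos : 0 < a.
Proof. apply exp_pos. Qed.

Lemma Rpower_xstar : Rpower a (p - 1) = K.
Proof.
unfold a, xstar, K. rewrite Rpower_mult.
replace (/ (1 - p) * (p - 1)) with (- (1)) by (field; lra).
rewrite Rpower_Ropp, Rpower_1; lra.
Qed.

(** As K = a^(p-1), the sign of H is read off from the antitonicity of x^(p-1). *)
Lemma H_factor x : 0 < x -> H p x = x * (K - Rpower x (p - 1)).
Proof. intros hx. unfold H. rewrite signed_pow_of_pos by exact hx. unfold K. ring. Qed.

Lemma signed_pow_xstar : signed_pow p a = K * a.
Proof.
pose proof xstar_pos. rewrite signed_pow_of_pos, Rpower_xstar by assumption. ring.
Qed.

Lemma H_nonpos x : 0 <= x <= a -> H p x <= 0.
Proof.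
intros hx. destruct (Req_dec x 0) as [->|hx0].
- unfold H. rewrite signed_pow_0. lra.
- rewrite H_factor by lra.
  pose proof (Rpower_p1_antitone x a ltac:(lra)) as h. rewrite Rpower_xstar in h. nra.
Qed.

Lemma H_gap e b :
  0 < e -> e <= b < a -> exists d, 0 < d /\ forall x, e <= x <= b -> H p x <= - d.
Proof.
(* On [e, b], the factor x is at least e and x^(p-1) is at least b^(p-1), which exceeds K. *)
intros he hb. exists (e * (Rpower b (p - 1) - K)).
pose proof (Rpower_p1_strict_antitone b a ltac:(lra)) as h. rewrite Rpower_xstar in h.
split; [apply Rmult_lt_0_compat; lra|].
intros x hx. rewrite H_factor by lra.
pose proof (Rpower_p1_antitone x b ltac:(lra)). nra.
Qed.

Lemma m_H_lower x : 0 <= x <= a -> m_H p <= H p x.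
Proof.
intros hx. unfold m_H.
set (P := fun z => _).
(* This crude bound excludes the infimum -oo and the member [H p x] excludes +oo, so [real] is
   faithful. *)
assert (hlow : forall z, P z -> - signed_pow p a <= z).
{ intros z [l [hl ->]]. unfold H.
  assert (0 <= / (1 - p) * l).
  { apply Rmult_le_pos; [left; apply Rinv_0_lt_compat|]; lra. }
  pose proof (signed_pow_mono l a hl). lra. }
destruct (Glb_Rbar_correct P) as [h1 h2].
specialize (h2 (- signed_pow p a) hlow).
assert (hP : P (H p x)) by (now exists x).
specialize (h1 _ hP).
destruct (Glb_Rbar P); simpl in *; tauto.
Qed.

Lemma m_H_nonpos : m_H p <= 0.
Proof.
pose proof xstar_pos as ha. replace 0 with (H p 0); [apply m_H_lower; lra|].
unfold H. rewrite signed_pow_0. ring.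
Qed.

(** The antiderivative of [H p] vanishing at 0; |x|^(p+1) is written with [signed_pow], which
    carries continuity at 0. *)
Definition potential (x : R) : R := K * x ^ 2 / 2 - x * signed_pow p x / (p + 1).

Lemma potential_continuous x : continuity_pt potential x.
Proof.
apply continuity_pt_filterlim. apply @continuous_minus.
- apply (ex_derive_continuous (fun x => K * x ^ 2 / 2)). now auto_derive.
- apply @continuous_mult; [|apply continuous_const].
  apply @continuous_mult; [apply continuous_id|apply signed_pow_continuous].
Qed.

Lemma potential_derive x : 0 < x -> is_derive potential x (K * x - signed_pow p x).
Proof.
intros hx. pose proof (signed_pow_derive x hx) as hd. unfold potential.
auto_derive; [ex_derive_by_hyp|]. rewrite_derive.
rewrite signed_pow_of_pos by exact hx. field. lra.
Qed.

(** From [signed_pow p a = K * a] and K (1 - p) = 1, the potential at a is -a^2/(2(1+p)). *)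
Lemma potential_drop : 2 * (potential 0 - potential a) = Rpower (1 - p) (2 / (1 - p)) / (1 + p).
Proof.
assert (ha2 : Rpower (1 - p) (2 / (1 - p)) = a ^ 2).
{ unfold a, xstar. simpl. rewrite Rmult_1_r, <- Rpower_plus. f_equal. field. lra. }
rewrite ha2. unfold potential. rewrite signed_pow_xstar, signed_pow_0. unfold K. field. lra.
Qed.

Lemma signed_pow_steep M :
  0 < M -> exists eps, 0 < eps <= a /\ forall x, 0 <= x <= eps -> M * x <= signed_pow p x.
Proof.
intros hM. pose proof xstar_pos as ha.
(* The point where x^(p-1) = M; to its left x^(p-1) is larger. *)
set (e := Rpower M (/ (p - 1))).
assert (he : 0 < e) by apply exp_pos.
exists (Rmin a e). split.
{ split; [now apply Rmin_glb_lt|apply Rmin_l]. }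
intros x hx. pose proof (Rmin_r a e).
destruct (Req_dec x 0) as [->|hx0]; [rewrite signed_pow_0; lra|].
rewrite signed_pow_of_pos by lra.
pose proof (Rpower_p1_antitone x e ltac:(lra)) as h.
replace (Rpower e (p - 1)) with M in h; [nra|].
unfold e. rewrite Rpower_mult, Rinv_l, Rpower_1; lra.
Qed.

End SignedPow.

(** * Odd extension and conclusion *)

Theorem theorem20 (p : R) (hp : 0 < p < 1) :
  exists (beta : R) (x y : R -> R),
    0 < beta /\
    sqrt (Rpower (1 - p) (2 / (1 - p)) / (1 + p)) <= beta /\
    beta <= sqrt (2 * ((xstar p - m_H p) ^ 2 - m_H p ^ 2)) /\
    solution_S p 0 beta x y /\
    is_lim x p_infty (xstar p) /\ is_lim y p_infty 0 /\
    is_lim x m_infty (- xstar p) /\ is_lim y m_infty 0 /\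
    (forall eta : R, Rabs (x eta) < xstar p) /\
    (forall eta : R, 0 < y eta <= beta).
Proof.
set (K := / (1 - p)).
assert (hK : 0 < K) by (apply Rinv_0_lt_compat; lra).
pose proof (xstar_pos p) as ha.
destruct (signed_pow_steep p hp (K + 5)) as (eps & heps & hsteep); [lra|].
destruct (half_line_profile K (xstar p) eps (signed_pow p))
  as (U & Y & hU0 & hU & hY & hUr & hUe); try assumption; try lra.
{ now apply signed_pow_continuous. }
{ now apply signed_pow_mono. }
{ apply signed_pow_0. }
{ now apply signed_pow_xstar. }
assert (hb : forall x, 0 <= x <= xstar p -> m_H p <= K * x - signed_pow p x <= 0).
{ intros x hx. split; [now apply (m_H_lower p hp)|now apply (H_nonpos p hp)]. }
assert (hgap : forall b, eps / 2 <= b < xstar p ->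
  exists d, 0 < d /\ forall x, eps / 2 <= x <= b -> K * x - signed_pow p x <= - d).
{ intros b hbb. apply (H_gap p hp); lra. }
assert (hm := m_H_nonpos p hp).
assert (hY_pos : forall t, 0 <= t -> 0 < Y t) by (intros; eapply Y_pos; eauto; lra).
assert (hY_le : forall t, 0 <= t -> Y t <= Y 0) by (intros; eapply Y_le; eauto; lra).
assert (hUl : is_lim U p_infty (xstar p)) by (eapply U_lim; eauto; lra).
assert (hYl : is_lim Y p_infty 0) by (eapply Y_lim; eauto; lra).
assert (hlow : 2 * (potential p 0 - potential p (xstar p)) <= Y 0 ^ 2).
{ eapply slope_lower; eauto; try lra.
  - now apply potential_continuous.
  - now apply potential_derive. }
assert (hup : Y 0 ^ 2 <= xstar p ^ 2 / 2 - 2 * m_H p * xstar p)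
  by (eapply slope_upper; eauto; lra).
pose proof (hY_pos 0 ltac:(lra)) as hbeta.
(* The system is invariant under (t, x, y) -> (-t, -x, y), so [x] is extended as odd and [y] as
   even. *)
set (x := fun t => if Rle_dec 0 t then U t else - U (- t)).
set (y := fun t => if Rle_dec 0 t then Y t else Y (- t)).
assert (hx : forall t, is_derive x t (y t)).
{ apply (is_derive_glue U (fun t => - U (- t)) Y (fun t => Y (- t))).
  - intros; apply hU.
  - intros t _. pose proof (hU (- t)) as h. auto_derive; [ex_derive_by_hyp|].
    rewrite_derive. ring.
  - rewrite Ropp_0, hU0. ring.
  - now rewrite Ropp_0. }
assert (hy : forall t, is_derive y t (K * x t - signed_pow p (x t) - / 2 * t * y t)).
{ intros t.
  assert (h := is_derive_glue Y (fun t => Y (- t))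
    (fun t => K * U t - signed_pow p (U t) - / 2 * t * Y t)
    (fun t => - (K * U (- t) - signed_pow p (U (- t)) - / 2 * (- t) * Y (- t)))).
  replace (K * x t - signed_pow p (x t) - / 2 * t * y t) with
    (if Rle_dec 0 t then K * U t - signed_pow p (U t) - / 2 * t * Y t
     else - (K * U (- t) - signed_pow p (U (- t)) - / 2 * (- t) * Y (- t))).
  - apply h.
    + exact hY.
    + intros s hs. pose proof (hY (- s) ltac:(lra)) as hd. auto_derive; [ex_derive_by_hyp|].
      rewrite_derive. ring.
    + now rewrite Ropp_0.
    + rewrite Ropp_0, hU0, signed_pow_0. ring.
  - unfold x, y. destruct (Rle_dec 0 t); [ring|]. rewrite signed_pow_opp. ring. }
assert (hxr : forall t, Rabs (x t) < xstar p).
{ intros t. unfold x. destruct (Rle_dec 0 t).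
  - pose proof (hUr t ltac:(lra)). rewrite Rabs_right; lra.
  - pose proof (hUr (- t) ltac:(lra)). rewrite Rabs_Ropp, Rabs_right; lra. }
assert (hyr : forall t, 0 < y t <= Y 0).
{ intros t. unfold y. destruct (Rle_dec 0 t); split; (apply hY_pos || apply hY_le); lra. }
assert (hxc : forall t, continuous x t)
  by (intros t; apply (ex_derive_continuous x); now exists (y t)).
assert (hyc : forall t, continuous y t)
  by (intros t; apply (ex_derive_continuous y); eexists; apply hy).
exists (Y 0), x, y. unfold solution_S.
repeat match goal with |- _ /\ _ => split end; try assumption.
- rewrite <- (sqrt_pow2 (Y 0)) by lra. apply sqrt_le_1_alt.
  rewrite <- potential_drop by exact hp. exact hlow.
(* With a = [xstar p] and m = [m_H p], the radicand is 2a^2 - 4am, at least a^2/2 - 2ma because m <=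
   0. *)
- rewrite <- (sqrt_pow2 (Y 0)) at 1 by lra. apply sqrt_le_1_alt. nra.
- now apply C1_of_derive with y.
- exists (xstar p). intros t. left. apply hxr.
(* The derivative of [y] is the right-hand side of the equation, continuous because [signed_pow]
   is. *)
- apply C1_of_derive with (1 := hy). intros t.
  apply @continuous_minus; [apply @continuous_minus|].
  + apply @continuous_mult; [apply continuous_const|apply hxc].
  + apply (continuous_comp x (signed_pow p)); [apply hxc|now apply signed_pow_continuous].
  + apply @continuous_mult; [|apply hyc].
    apply (ex_derive_continuous (fun t => / 2 * t)). now auto_derive.
- exists (Y 0). intros t. pose proof (hyr t). rewrite Rabs_right; lra.
- unfold x. destruct (Rle_dec 0 0); lra.
- unfold y. destruct (Rle_dec 0 0); lra.
- apply (is_lim_ext_loc U); [|exact hUl].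
  exists 0. intros t ht. unfold x. destruct (Rle_dec 0 t); lra.
- apply (is_lim_ext_loc Y); [|exact hYl].
  exists 0. intros t ht. unfold y. destruct (Rle_dec 0 t); lra.
- apply (is_lim_ext_loc (fun t => - U (- t))).
  { exists 0. intros t ht. unfold x. destruct (Rle_dec 0 t); lra. }
  apply (is_lim_opp (fun t => U (- t)) m_infty (xstar p)).
  apply (is_lim_comp U Ropp m_infty (xstar p) p_infty hUl); [|now exists 0].
  apply (is_lim_opp (fun t => t) m_infty m_infty), is_lim_id.
- apply (is_lim_ext_loc (fun t => Y (- t))).
  { exists 0. intros t ht. unfold y. destruct (Rle_dec 0 t); lra. }
  apply (is_lim_comp Y Ropp m_infty 0 p_infty hYl); [|now exists 0].
  apply (is_lim_opp (fun t => t) m_infty m_infty), is_lim_id.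
Qed.
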